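(* For each $n\ge 2$ and each $k$, the values $\gamma_k(\mathcal D_{n,s})$, $s=0,1,\dots,n$, form an arithmetic sequence in $s$; that is, $\gamma_k(\mathcal D_{n,s+1})-\gamma_k(\mathcal D_{n,s})$ does not depend on $s\in\{0,\dots,n-1\}$.
   Context: For $0\le s\le n$, $\mathcal D_{n,s}$ is the (simplicial) arrangement in $\mathbb R^n$ of hyperplanes with normal vectors $e_i\pm e_j$ ($1\le i<j\le n$) and $e_i$ ($1\le i\le s$). For a simplicial arrangement of rank $d$, the cones obtained as intersections of chambers form a simplicial complex triangulating a $(d-1)$-sphere; with $f_k$ its number of $k$-dimensional simplices, $h(t)=\sum_{i=0}^d f_{d-1-i}(t-1)^i$ is palindromic and the $\gamma$-vector is defined by $h(t)=\sum_{i=0}^{\lfloor d/2\rfloor}\gamma_i t^i(1+t)^{d-2i}$. *)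

(* Defs.v *)
From HB Require Import structures.
From mathcomp Require Import all_boot all_order all_algebra.
From mathcomp Require Import finmap.
From mathcomp Require Import all_classical all_reals all_analysis.

Set Implicit Arguments.
Unset Strict Implicit.
Unset Printing Implicit Defensive.

Import Order.TTheory GRing.Theory Num.Theory.
Import numFieldNormedType.Exports.

Local Open Scope classical_set_scope.
Local Open Scope ring_scope.

(* A central hyperplane arrangement is given by a finite list of normals. *)
Definition arrangement (R : realType) (n : nat) := seq 'rV[R]_n.

Section Arrangement.
Context {R : realType} {n : nat}.
Implicit Types (A : arrangement R n) (v : 'rV[R]_n) (c : set 'rV[R]_n).

Definition hyperplane v : set 'rV[R]_n := [set x | (x *m v^T) 0 0 = 0].

Definition arr_rank A : nat := \dim <<A>>%VS.

Definition arr_complement A : set 'rV[R]_n :=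
  ~` \bigcup_(v in [set` A]) hyperplane v.

(* Chambers are closed: closures of the components of the complement. *)
Definition chambers A : set (set 'rV[R]_n) :=
  [set closure (connected_component (arr_complement A) x)
     | x in arr_complement A].

Definition cones A : set (set 'rV[R]_n) :=
  [set \bigcap_(C in F) C | F in [set F | F !=set0 /\ F `<=` chambers A]].

(* The linear span of c has dimension m: c contains a basis of its span,
   namely the m rows of B. *)
Definition cone_dim c (m : nat) : Prop :=
  exists B : 'M[R]_(m, n),
    [/\ row_free B, forall i, c (row i B) & forall x, c x -> (x <= B)%MS].

(* Every cone contains the intersection of all the hyperplanes, which has
   dimension n - arr_rank A.  Modulo this subspace, a cone of dimension k + 1
   gives a simplex of dimension k; the least cone is the empty simplex
   (k = -1). *)
Definition simplices A (k : int) : set (set 'rV[R]_n) :=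
  [set c | cones A c /\ exists2 m : nat, cone_dim c m &
     k = m%:Z - (n - arr_rank A)%N%:Z - 1].

(* The finite cardinal; the set of cones of an arrangement is finite. *)
Definition f_number A (k : int) : nat := #|` fset_set (simplices A k)|%fset.

Definition h_poly A : {poly int} :=
  let d := arr_rank A in
  \sum_(i < d.+1) (f_number A (d%:Z - 1 - i%:Z))%:R *: ('X - 1) ^+ i.

(* Entries of index greater than d./2 are set to 0, so that there is at most
   one such g. *)
Definition is_gamma_vector A (g : nat -> int) : Prop :=
  let d := arr_rank A in
  (forall i, (d./2 < i)%N -> g i = 0) /\
  h_poly A = \sum_(i < d./2.+1) g i *: ('X^i * (1 + 'X) ^+ (d - i.*2)).

Definition gamma A : nat -> int := xget (fun=> 0) (is_gamma_vector A).

End Arrangement.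

(* The coordinates 1..n are indexed by 'I_n, so that 1 <= i <= s reads
   i < s. *)
Definition arrD (R : realType) (n s : nat) : arrangement R n :=
  let e (i : 'I_n) : 'rV[R]_n := delta_mx 0 i in
  [seq e p.1 + e p.2 | p in [pred p : 'I_n * 'I_n | (p.1 < p.2)%N]] ++
  [seq e p.1 - e p.2 | p in [pred p : 'I_n * 'I_n | (p.1 < p.2)%N]] ++
  [seq e i | i in [pred i : 'I_n | (i < s)%N]].

(* Main.v *)
Require Import Defs.
From HB Require Import structures.
From mathcomp Require Import all_boot all_order all_algebra.
From mathcomp Require Import all_classical all_reals all_analysis.
From mathcomp Require Import ring lra zify.

(* The cones of a central arrangement A correspond to the sign vectors of the
   points of R^n, and the dimension of the cone of x is that of the space of
   all y orthogonal to the normals orthogonal to x.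

   For D_{n,s}, two points have the same sign vector iff they have the same
   signs and the same order of absolute values, except that the sign of x_i is
   invisible when i > s and |x_i| is the strict minimum.  Hence the cones of
   dimension m are counted by the words w in {-n..n}^n with
   {|w_i|} \ {0} = {1..m}, such that w_i > 0 whenever i > s and |w_i| is the
   strict minimum.  For each i > s this condition removes the same number of
   words, so the h-polynomial is h_s = B_n - (n - s) 2^(n-1) X A_{n-1}, with
   A and B the Eulerian polynomials of types A and B.  Their differential
   recurrences show that B_n and X A_{n-1} both have a gamma-vector of degree
   n, so gamma_k is affine in s. *)

Set Implicit Arguments.
Unset Strict Implicit.
Unset Printing Implicit Defensive.

Import Order.TTheory GRing.Theory Num.Theory.
Local Open Scope ring_scope.

(** * Surjection numbers *)

(* The number of maps from an n-set to m pairs {a, -a} and e extra values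
   (e = 1: zero is allowed, e = 0: it is not) that meet every pair. *)
Fixpoint surj (e n m : nat) : nat :=
  if n is n'.+1
  then ((m.*2 + e) * surj e n' m + m.*2 * surj e n' m.-1)%N
  else (m == 0)%N.

Lemma surj_large e n m : (n < m)%N -> surj e n m = 0%N.
Proof.
elim: n m => [|n IH] m ltnm /=; first by rewrite eqn0Ngt ltnm.
by rewrite !IH ?muln0 //; lia.
Qed.

(** Maps into all [M] pairs and the extra values, sorted by the set of pairs that they meet. *)
Lemma sum_bin_surj e n M :
  (\sum_(m < M.+1) 'C(M, m) * surj e n m = (M.*2 + e) ^ n)%N.
Proof.
elim: n => [|n IH] /=.
  rewrite big_ord_recl bin0 eqxx big1 // => i _.
  by rewrite lift0 muln0.
rewrite expnS -IH big_distrr /=.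
(* The second sum is shifted so that both carry [surj e n m];
   [(m + 1) C(M, m + 1) = (M - m) C(M, m)] then turns the coefficient into [C(M, m) (2 M + e)]. *)
transitivity (\sum_(m < M.+1) ('C(M, m) * ((m.*2 + e) * surj e n m)
   + 'C(M, m.+1) * (m.+1.*2 * surj e n m)))%N.
  rewrite (eq_bigr (fun m : 'I__ => 'C(M, m) * ((m.*2 + e) * surj e n m) +
    'C(M, m) * (m.*2 * surj e n m.-1)))%N; last by move=> i _; rewrite mulnDr.
  rewrite !big_split /=; congr addn.
  rewrite big_ord_recl big_ord_recr /= muln0 add0n bin_small // mul0n addn0.
  by apply: eq_bigr => i _.
apply: eq_bigr => m _.
have := mul_bin_left M m; have := ltn_ord m => lt1 H.
have -> : ('C(M, m.+1) * (m.+1.*2 * surj e n m) =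
           (m.+1 * 'C(M, m.+1)).*2 * surj e n m)%N by rewrite -!muln2; ring.
rewrite H -!muln2; move: (nat_of_ord m) lt1 {H} => {}m lt1.
have [k ->] : exists k, M = (m + k)%N by exists (M - m)%N; lia.
have -> : (m + k - m = k)%N by lia.
ring.
Qed.

(** Inversion over subsets, by induction on [#|S|]: the proper subsets contribute as in
    [sum_bin_surj], so the top terms agree. Counting words with a given level set thus reduces to
    counting words with levels inside a set. *)
Lemma surj_unique (T : finType) e n (N : {set T} -> nat) :
  (forall S : {set T}, \sum_(U : {set T} | U \subset S) N U = (#|S|.*2 + e) ^ n)%N ->
  forall S, N S = surj e n #|S|.
Proof.
move=> HN S; move: {2}#|S|.+1 (ltnSn #|S|) => k; elim: k S => // k IH S ltSk.
have := HN S; rewrite -sum_bin_surj (bigD1 S) //= big_ord_recr /= binn mul1n.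
suff -> : (\sum_(i : {set T} | (i \subset S) && (i != S)) N i =
   \sum_(i < #|S|) 'C(#|S|, i) * surj e n i)%N by rewrite addnC => /addnI.
have lt_sub (U : {set T}) : (U \subset S) && (U != S) -> (#|U| < #|S|)%N.
  case/andP=> sUS neqUS; apply: proper_card.
  by rewrite finset.properEneq neqUS.
rewrite (eq_bigr (fun U : {set T} => surj e n #|U|)); last first.
  by move=> U /lt_sub ltU; apply: IH; lia.
have [S0|S0] := posnP #|S|.
  by rewrite big1 => [|U /lt_sub]; rewrite S0 // big_ord0.
(* Proper subsets have cardinality below [#|S|]; the reduction modulo [#|S|] leaves it unchanged and
   makes it an ordinal. *)
rewrite (partition_big (fun U : {set T} => Ordinal (ltn_pmod #|U| S0)) predT) //=.
apply: eq_bigr => i _.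
rewrite -cards_draws -sum1dep_card big_distrl /=.
apply: eq_big => [U|U /andP[/lt_sub ltU /eqP]]; last first.
  by move/(congr1 val); rewrite /= modn_small // => <-; rewrite mul1n.
apply/idP/idP.
  case/andP=> HU; rewrite -(inj_eq val_inj) /= modn_small ?lt_sub //.
  by case/andP: HU => -> _ ->.
case/andP=> sUS /eqP cU; rewrite sUS /=.
have -> /= : U != S by apply/eqP => US; move: (ltn_ord i); rewrite -cU US ltnn.
by rewrite -(inj_eq val_inj) /= cU modn_small.
Qed.

(** * Gamma expansions of the Eulerian polynomials *)

Definition gamma_basis (d i : nat) : {poly int} := 'X^i * (1 + 'X) ^+ (d - i.*2).

Definition gamma_span (d : nat) (p : {poly int}) : Prop :=
  exists g : nat -> int, p = \sum_(i < d./2.+1) g i *: gamma_basis d i.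

Lemma gamma_spanD d p q : gamma_span d p -> gamma_span d q -> gamma_span d (p + q).
Proof.
move=> [g ->] [h ->]; exists (fun i => g i + h i).
by rewrite -big_split; apply: eq_bigr => i _; rewrite scalerDl.
Qed.

Lemma gamma_spanZ d (c : int) p : gamma_span d p -> gamma_span d (c *: p).
Proof.
move=> [g ->]; exists (fun i => c * g i).
by rewrite scaler_sumr; apply: eq_bigr => i _; rewrite scalerA.
Qed.

Lemma gamma_span0 d : gamma_span d 0.
Proof. by exists (fun=> 0); rewrite big1 // => i _; rewrite scale0r. Qed.

Lemma gamma_span_basis d i : (i.*2 <= d)%N -> gamma_span d (gamma_basis d i).
Proof.
move=> le_id; have lt_i : (i < d./2.+1)%N by lia.
exists (fun j => (j == i)%:R); rewrite (bigD1 (Ordinal lt_i)) //= eqxx scale1r.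
rewrite big1 ?addr0 // => j neqj.
by rewrite (_ : (val j == i) = false) ?scale0r //; apply: negbTE neqj.
Qed.

Lemma gamma_span_linear d d' (f : {linear {poly int} -> {poly int}}) :
  (forall i, (i.*2 <= d)%N -> gamma_span d' (f (gamma_basis d i))) ->
  forall p, gamma_span d p -> gamma_span d' (f p).
Proof.
move=> Hf p [g ->]; rewrite linear_sum; elim/big_ind: _ => [||i _].
- exact: gamma_span0.
- by move=> p1 p2; apply: gamma_spanD.
- by rewrite linearZ /=; apply/gamma_spanZ/Hf; move: (ltn_ord i); lia.
Qed.

Lemma gamma_span_mul1X d p : gamma_span d p -> gamma_span d.+1 ((1 + 'X) * p).
Proof.
apply: (@gamma_span_linear _ _ ((1 + 'X) \*o idfun)) => i le_id /=.
have -> : (1 + 'X) * gamma_basis d i = gamma_basis d.+1 i.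
  by rewrite /gamma_basis subSn // exprS mulrCA.
by apply: gamma_span_basis; lia.
Qed.

(* The operator raising the degree in the recurrences of the Eulerian
   polynomials of types A and B. *)
Definition euler_op (d : nat) (p : {poly int}) : {poly int} :=
  d%:R *: ('X * p) + 'X * (1 - 'X) * p^`().

Lemma euler_op_is_linear d : linear (euler_op d).
Proof.
move=> c p q; rewrite /euler_op derivD derivZ -!mul_polyC; ring.
Qed.

HB.instance Definition _ d := GRing.isLinear.Build int {poly int} {poly int} _
  (euler_op d) (euler_op_is_linear d).

(** With [k = d - 2 i], the terms in [i] are collected by [(1 - X) + 2 X = 1 + X] and those in [k]
    by [(1 - X) + (1 + X) = 2]. *)
Lemma euler_op_basis d i : (i.*2 <= d)%N ->
  euler_op d (gamma_basis d i) =
  i%:R *: gamma_basis d.+1 i + (2 * (d - i.*2))%:R *: gamma_basis d.+1 i.+1.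
Proof.
move=> le_id; rewrite /euler_op /gamma_basis.
have [k ->] : exists k, (d = i.*2 + k)%N by exists (d - i.*2)%N; lia.
have -> : (i.*2 + k - i.*2 = k)%N by lia.
have -> : ((i.*2 + k).+1 - i.*2 = k.+1)%N by lia.
have -> : ((i.*2 + k).+1 - i.+1.*2 = k.-1)%N by lia.
rewrite derivM derivXn deriv_exp derivD derivX derivC add0r mul1r !scaler_nat.
case: i le_id => [|i] _; case: k => [|k] /=; rewrite ?muln0 ?mulr0n -?addnn ?exprS.
- ring.
- move: ((1 + 'X) ^+ k) => B; ring.
- move: ('X^i) => A; ring.
- move: ('X^i) ((1 + 'X) ^+ k) => A B; ring.
Qed.

Lemma gamma_span_euler_op d p : gamma_span d p -> gamma_span d.+1 (euler_op d p).
Proof.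
apply: gamma_span_linear => i le_id /=; rewrite euler_op_basis //.
apply: gamma_spanD.
  by apply/gamma_spanZ/gamma_span_basis; lia.
(* For [d = 2 i] the index [i.+1] is out of range in degree [d.+1], but its coefficient vanishes. *)
have [->|gt0] := posnP (d - i.*2); first by rewrite scale0r; apply: gamma_span0.
by apply/gamma_spanZ/gamma_span_basis; lia.
Qed.

(** Frobenius form of the Eulerian polynomials: [eul 1 n] is that of type B, and [eul 0 n] is
    [2 ^ n] times that of the permutations of [n] letters. *)
Definition eul (e n : nat) : {poly int} :=
  \sum_(m < n.+1) (surj e n m)%:R *: ('X - 1) ^+ (n - m).

(** It holds term by term: since [X (1 - X)] times the derivative of [(X - 1) ^ k] is
    [- k X (X - 1) ^ k], the term of index [m] is multiplied by [(2 m + e) X + 2 - e] on both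
    sides. *)
Lemma eulS e n :
  eul e n.+1 = (2 - e%:R + (2 * n + e)%:R * 'X) * eul e n
               + 2 * 'X * (1 - 'X) * (eul e n)^`().
Proof.
transitivity (\sum_(m < n.+1)
   ((m.*2 + e) * surj e n m)%:R *: ('X - 1) ^+ (n - m).+1 +
   \sum_(m < n.+1)
   (m.+1.*2 * surj e n m)%:R *: ('X - 1) ^+ (n - m) : {poly int}).
  rewrite /eul /=.
  under eq_bigr do rewrite natrD scalerDl.
  rewrite big_split /=; congr (_ + _).
    rewrite big_ord_recr /= surj_large // muln0 scale0r addr0.
    by apply: eq_bigr => m _; rewrite subSn // -ltnS.
  rewrite big_ord_recl /= mul0n scale0r add0r.
  by apply: eq_bigr => m _; rewrite /bump /= add1n subSS.
rewrite -big_split /= /eul linear_sum !mulr_sumr -big_split /=.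
apply: eq_bigr => m _.
move: (nat_of_ord m) (ltn_ord m) (surj _ _ _) => {}m lt_mn c.
have [k ->] : exists k, (n = m + k)%N by exists (n - m)%N; lia.
rewrite addKn derivZ deriv_exp derivB derivX derivC subr0 mul1r.
rewrite !scaler_nat -!addnn.
case: k => [|k] /=; first by rewrite mulr0n expr1 expr0; ring.
rewrite !exprS; move: (('X - 1) ^+ k) => B; ring.
Qed.

Lemma gamma_span_eul1 n : gamma_span n (eul 1 n).
Proof.
elim: n => [|n IH].
  rewrite /eul big_ord1 /= scale1r expr0.
  by have := @gamma_span_basis 0 0 isT; rewrite /gamma_basis !expr0 mulr1.
(* The type B recurrence is a sum of two operators, each raising the degree of a gamma expansion by
   one. *)
have -> : eul 1 n.+1 = (1 + 'X) * eul 1 n + 2%:R *: euler_op n (eul 1 n).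
  rewrite eulS /euler_op !scaler_nat; ring.
apply: gamma_spanD; first exact: gamma_span_mul1X.
apply: gamma_spanZ; exact: gamma_span_euler_op.
Qed.

(** After multiplication by ['X], the type A recurrence is [2 euler_op] alone; it starts at [n = 1]
    from [2 X], twice a basis element of degree 2. *)
Lemma gamma_span_eul0 n : (0 < n)%N -> gamma_span n.+1 ('X * eul 0 n).
Proof.
case: n => // n _; elim: n => [|n IH].
  rewrite eulS /eul big_ord1 /= scale1r expr0 derivC mulr0 addr0.
  have := @gamma_spanZ _ 2%:R _ (@gamma_span_basis 2 1 isT).
  rewrite /gamma_basis subnn expr0 scaler_nat.
  by congr gamma_span; ring.
have -> : 'X * eul 0 n.+2 = 2%:R *: euler_op n.+2 ('X * eul 0 n.+1).
  rewrite eulS /euler_op !scaler_nat derivM derivX; ring.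
apply: gamma_spanZ; exact: gamma_span_euler_op.
Qed.

(** The two summands come from [X = (X - 1) + 1]; the factor [0 < m] is there because [0.-1] is
    [0]. *)
Lemma mulX_eul n :
  'X * eul 0 n = \sum_(m < n.+2)
     (surj 0 n m + (0 < m) * surj 0 n m.-1)%:R *: ('X - 1) ^+ (n.+1 - m).
Proof.
under eq_bigr do rewrite natrD scalerDl.
rewrite big_split /= big_ord_recr /= surj_large // scale0r addr0.
rewrite [X in _ + X]big_ord_recl /= mul0n scale0r add0r.
have {1}-> : 'X = ('X - 1) + 1 :> {poly int} by rewrite subrK.
rewrite mulrDl mul1r /eul mulr_sumr; congr (_ + _); apply: eq_bigr => m _.
  by rewrite -scalerAr -exprS subSn // -ltnS.
by rewrite /bump /= add1n mul1n subSS.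
Qed.

(** Triangularity: the lowest term of [gamma_basis d i] is [X ^ i] with coefficient 1. *)
Lemma gamma_basis_free d (g : nat -> int) :
  \sum_(i < d./2.+1) g i *: gamma_basis d i = 0 ->
  forall i, (i <= d./2)%N -> g i = 0.
Proof.
move=> sum0 i; elim/ltn_ind: i => i IH le_id.
have lt_id : (i < d./2.+1)%N by [].
have := congr1 (fun p : {poly int} => p`_i) sum0; rewrite coef0 coef_sum.
rewrite (bigD1 (Ordinal lt_id)) //= coefZ coefXnM ltnn subnn.
rewrite -horner_coef0 !hornerE expr1n mulr1 big1 ?addr0 // => j neq_ji.
rewrite coefZ; have [lt_ji|lt_ij|eq_ji] := ltngtP j i.
- by rewrite IH ?mul0r //; lia.
- by rewrite coefXnM lt_ij mulr0.
- by move/eqP: neq_ji; case; apply: val_inj.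
Qed.

(** * Counting canonical words *)

(* [None] is the value 0 and [Some (b, a)] the value [(-1)^b * (a + 1)]. *)
Notation letter n := (option (bool * 'I_n)).
Notation word n := {ffun 'I_n -> letter n}.

Definition amp {n : nat} (v : letter n) : nat := if v is Some (_, a) then a.+1 else 0.

Definition levels {n : nat} (w : word n) : {set 'I_n} :=
  [set a : 'I_n | [exists i, amp (w i) == a.+1]].

(** The ordinal [a] stands for the absolute value [a + 1], so for [m <= n] the equation
    [levels w = below n m] says that the nonzero absolute values in [w] are exactly [1..m]. *)
Definition below (n m : nat) : {set 'I_n} := [set a : 'I_n | (a < m)%N].

Definition lev_in {n : nat} (S : {set 'I_n}) (v : letter n) : bool :=
  if v is Some (_, a) then a \in S else true.

Lemma levelsP {n : nat} (w : word n) a :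
  reflect (exists i b, w i = Some (b, a)) (a \in levels w).
Proof.
rewrite inE; apply: (iffP existsP) => [[i]|[i [b wi]]]; last first.
  by exists i; rewrite wi.
case wi: (w i) => [[b c]|] //= /eqP[/val_inj eq_ca].
by exists i, b; rewrite wi eq_ca.
Qed.

Lemma levels_subset {n : nat} (w : word n) (S : {set 'I_n}) :
  (levels w \subset S) = [forall i, lev_in S (w i)].
Proof.
apply/fintype.subsetP/forallP => [sub i|all_in a /levelsP[i [b wi]]].
  case wi: (w i) => [[b a]|] //=; apply: sub; apply/levelsP.
  by exists i, b.
by have := all_in i; rewrite wi.
Qed.

(** A word with all levels in [S] is an independent choice of one letter per place. This brings
    letterwise constraints [G] into the form required by [surj_unique]. *)
Lemma sum_card_levels {n : nat} (G : 'I_n -> pred (letter n)) (S : {set 'I_n}) :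
  (\sum_(U : {set 'I_n} | U \subset S)
     #|[set w : word n | [forall i, G i (w i)] & levels w == U]| =
   \prod_i #|[pred v : letter n | G i v && lev_in S v]|)%N.
Proof.
transitivity #|[set w : word n | [forall i, G i (w i)] & levels w \subset S]|.
  rewrite -sum1dep_card (partition_big levels (fun U => U \subset S)) /=.
    apply: eq_bigr => U sUS; rewrite -sum1dep_card; apply: eq_bigl => w.
    by rewrite -andbA; case: eqP => [->|]; rewrite ?sUS ?andbF.
  by move=> w /andP[].
pose F i := [pred v : letter n | G i v && lev_in S v].
transitivity #|(family F : simpl_pred (word n))|.
  apply: eq_card => w; rewrite inE levels_subset.
  apply/andP/familyP => [[/forallP HG /forallP HS] i|HF].
    by rewrite inE HG HS.
  by split; apply/forallP => i; have := HF i; rewrite inE => /andP[].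
rewrite card_family /image_mem foldrE big_map enumT.
by apply: eq_bigr.
Qed.

Lemma card_nonzero_letters {n : nat} (S : {set 'I_n}) :
  #|[pred v : letter n | (v != None) && lev_in S v]| = #|S|.*2.
Proof.
have -> : #|S|.*2 = #|finset.setX (finset.setT : {set bool}) S|.
  by rewrite cardsX cardsT card_bool mul2n.
rewrite -(card_imset _ (@Some_inj _)).
apply: eq_card => v; rewrite !inE; apply/idP/imsetP.
  by case: v => // [[b a]] /= aS; exists (b, a); rewrite // !inE aS.
by case=> [[b a]]; rewrite !inE /= => aS ->.
Qed.

Lemma card_letters {n : nat} (S : {set 'I_n}) :
  #|[pred v : letter n | lev_in S v]| = (#|S|.*2 + 1)%N.
Proof.
rewrite (cardD1 None) inE /= addnC -card_nonzero_letters; congr addn.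
Qed.

Lemma card_words {n : nat} (S : {set 'I_n}) :
  #|[set w : word n | levels w == S]| = surj 1 n #|S|.
Proof.
move: S; apply: surj_unique => S.
transitivity (\prod_(i < n) #|[pred v : letter n | predT v && lev_in S v]|)%N.
  rewrite -sum_card_levels; apply: eq_bigr => U _; apply: eq_card => w.
  rewrite !inE; rewrite (_ : [forall i, _] = true) //; exact/forallP.
by rewrite prod_nat_const card_ord (eq_card (B := [pred v | lev_in S v])) // card_letters.
Qed.

Definition zero_at {n : nat} (i : 'I_n) (w : word n) : bool :=
  [forall j, (w j == None) == (j == i)].

(** The letter at [i] is forced and the [n.-1] others are nonzero, hence [e = 0]. *)
Lemma card_zero_at {n : nat} (i : 'I_n) (S : {set 'I_n}) :
  #|[set w : word n | zero_at i w & levels w == S]| = surj 0 n.-1 #|S|.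
Proof.
move: S; apply: surj_unique => S.
rewrite addn0 (sum_card_levels (fun j v => (v == None) == (j == i))).
rewrite (bigD1 i) //= (eq_card (B := pred1 None)) ?card1 ?mul1n; last first.
  by move=> v; rewrite !inE eqxx eqb_id; case: v => [[]|].
rewrite (eq_bigr (fun=> #|S|.*2)) => [|j /negbTE neq_ji].
  rewrite prod_nat_const; congr (_ ^ _)%N.
  by transitivity #|predC1 i|; [exact: eq_card | rewrite cardC1 card_ord].
by rewrite -card_nonzero_letters; apply: eq_card => v; rewrite !inE neq_ji eqbF_neg.
Qed.

(** * Canonical words and the words that they exclude *)

Definition lone {n : nat} (w : word n) (i : 'I_n) : bool :=
  [forall j, (j != i) ==> (amp (w i) < amp (w j))%N].

Definition positive {n : nat} (v : letter n) : bool :=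
  if v is Some (false, _) then true else false.

(* When i >= s and [|x_i|] is the strict minimum of the absolute values of x,
   the arrangement D_{n,s} does not see the sign of [x_i]. *)
Definition canon {n : nat} (s : nat) (w : word n) : bool :=
  [forall i : 'I_n, (s <= i)%N && lone w i ==> positive (w i)].

Definition canon_words (n s m : nat) : {set word n} :=
  [set w : word n | levels w == below n m & canon s w].

Lemma loneP {n : nat} (w : word n) i :
  reflect (forall j, j != i -> (amp (w i) < amp (w j))%N) (lone w i).
Proof. exact: (iffP forall_inP). Qed.

Lemma lone_inj {n : nat} (w : word n) i j : lone w i -> lone w j -> i = j.
Proof.
move=> /loneP loni /loneP lonj; apply/eqP/negPn/negP => neq_ij.
have := lonj i neq_ij; have := loni j; rewrite eq_sym neq_ij => /(_ isT).
lia.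
Qed.

Lemma card_below n m : (m <= n)%N -> #|below n m| = m.
Proof.
move=> le_mn; rewrite cardsE -sum1_card -(big_ord_widen n (fun=> 1%N) le_mn).
by rewrite sum1_card card_ord.
Qed.

Lemma zero_atP {n : nat} (w : word n) i :
  reflect (w i = None /\ forall j, j != i -> w j <> None) (zero_at i w).
Proof.
apply: (iffP forallP) => [H|[wi H] j].
  split=> [|j neq_ji]; first by have := H i; rewrite eqxx => /eqP/eqP.
  by have := H j; rewrite (negbTE neq_ji) => /eqP/eqP.
have [->|neq_ji] := eqVneq j i; first by rewrite wi eqxx.
by apply/eqP/negbTE/eqP/H.
Qed.

Lemma zero_at_lone {n : nat} (w : word n) i :
  zero_at i w = lone w i && (w i == None).
Proof.
apply/zero_atP/andP => [[wi H]|[/loneP lon /eqP wi]].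
  split; last by rewrite wi.
  by apply/loneP => j /H; rewrite wi; case: (w j) => [[b a]|].
by split=> // j /lon + wj; rewrite wj ltn0.
Qed.

Definition set_letter {n : nat} (i : 'I_n) (v : letter n) (w : word n) : word n :=
  [ffun j => if j == i then v else w j].

(** A negative strict minimum must be [-1]; replacing it by [0] gives a bijection onto the words
    whose only zero is at [i] and whose levels are [2..m+1]. *)
Lemma card_negative_lone {n m : nat} (i : 'I_n) : (m < n)%N ->
  #|[set w : word n | levels w == below n m.+1
      & lone w i && [exists a, w i == Some (true, a)]]| = surj 0 n.-1 m.
Proof.
move=> lt_mn; have n0 : (0 < n)%N by case: (n) i => [[]|].
pose o := Ordinal n0.
have co : #|below n m.+1 :\ o| = m.
  have := cardsD1 o (below n m.+1); rewrite card_below // inE /= add1n => -[].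
  by move=> <-.
rewrite -[in RHS]co -(card_zero_at i).
rewrite -[RHS](card_in_imset (f := set_letter i (Some (true, o)))); last first.
  move=> w1 w2; rewrite inE => /andP[/zero_atP[w1i _] _].
  rewrite inE => /andP[/zero_atP[w2i _] _].
  move=> /ffunP eqw; apply/ffunP => j; have := eqw j; rewrite !ffunE.
  by case: eqP => [->|//]; rewrite w1i w2i.
congr #|pred_of_set _|; apply/setP => w; apply/idP/imsetP.
  rewrite inE => /and3P[/eqP lw /loneP lon /existsP[a /eqP wi]].
  (* The absolute value 1 is attained; if this happened away from [i], the nonzero letter at [i]
     would have absolute value below 1. *)
  have ao : a = o.
    apply/eqP/negPn/negP => neq_ao.
    have /levelsP[j [b wj]] : o \in levels w by rewrite lw inE.
    have := lon j; rewrite wi wj; case: eqVneq => [ji|_ /(_ isT)//].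
    by case: neq_ao; move: wj; rewrite ji wi => -[_ ->].
  exists (set_letter i None w); last first.
    by apply/ffunP => j; rewrite !ffunE; case: eqP => // ->; rewrite wi ao.
  rewrite inE; apply/andP; split.
    apply/zero_atP; rewrite ffunE eqxx; split=> // j neq_ji.
    rewrite ffunE (negbTE neq_ji) => wj; have := lon j neq_ji.
    by rewrite wj ltn0.
  rewrite -lw; apply/eqP/setP => c; rewrite in_setD1; apply/levelsP/andP.
    case=> j [b]; rewrite ffunE; case: eqVneq => // neq_ji wj.
    split; last by apply/levelsP; exists j, b.
    have := lon j neq_ji; rewrite wi wj /= ao => lt0.
    by apply/eqP => co0; move: lt0; rewrite co0.
  case=> neq_co /levelsP[j [b wj]]; exists j, b; rewrite ffunE.
  by case: eqVneq => // ji; move: neq_co; rewrite -ao; move: wj; rewrite ji wi => -[_ ->]; rewrite eqxx.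
case=> w'; rewrite inE => /andP[/zero_atP[w'i w'j] /eqP lw'] ->.
rewrite inE; apply/and3P; split.
- apply/eqP/setP => c; apply/levelsP/idP.
    case=> j [b]; rewrite ffunE; case: eqVneq => [_ [_ <-]|neq_ji wj].
      by rewrite inE.
    have : c \in levels w' by apply/levelsP; exists j, b.
    by rewrite lw' in_setD1 => /andP[].
  move=> cm; have [->|neq_co] := eqVneq c o.
    by exists i, true; rewrite ffunE eqxx.
  have : c \in levels w' by rewrite lw' in_setD1 neq_co.
  case/levelsP=> j [b wj]; exists j, b; rewrite ffunE; case: eqP => // ji.
  by move: wj; rewrite ji w'i.
- apply/loneP => j neq_ji; rewrite !ffunE eqxx (negbTE neq_ji) /=.
  case wj: (w' j) (w'j j neq_ji) => [[b c]|] //= _.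
  have : c \in levels w' by apply/levelsP; exists j, b.
  by rewrite lw' in_setD1 -(inj_eq val_inj) /= ltnS lt0n => /andP[].
- by apply/existsP; exists o; rewrite ffunE eqxx.
Qed.

(** The number of words excluded by one place [i >= s]: the strict minimum is [0] in the first
    summand and [-1] in the second. For positive [n] these are also the coefficients of
    ['X * eul 0 n.-1] in [mulX_eul]. *)
Definition defect (n m : nat) : nat := (surj 0 n.-1 m + (0 < m) * surj 0 n.-1 m.-1)%N.

Lemma card_lone {n m : nat} (i : 'I_n) : (m <= n)%N ->
  #|[set w : word n | levels w == below n m & lone w i && ~~ positive (w i)]|
  = defect n m.
Proof.
move=> le_mn.
rewrite -(cardsID [set w : word n | w i == None]); congr addn.
  rewrite -[in RHS](@card_below n m) // -(card_zero_at i); apply: eq_card => w.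
  rewrite !inE zero_at_lone; case: (w i) => [[[] a]|] //=;
  by rewrite ?andbF ?andbT // andbC.
case: m le_mn => [|m] lt_mn /=; last rewrite mul1n -(card_negative_lone i) //.
  rewrite mul0n; apply: eq_card0 => w; rewrite !inE; apply/negP => /and4P[wi /eqP lw _].
  case E: (w i) wi => [[b a]|] // _ _.
  have : a \in levels w by apply/levelsP; exists i, b.
  by rewrite lw inE.
apply: eq_card => w; rewrite !inE.
have -> : [exists a, w i == Some (true, a)] = (w i != None) && ~~ positive (w i).
  apply/existsP/andP => [[a /eqP ->] //|].
  by case: (w i) => [[[] a] [_ pos]|[]] //=; exists a.
by rewrite andbC -!andbA; congr (_ && _); congr (_ && _); rewrite andbC.
Qed.

(** A word has at most one strict minimum, so a noncanonical word violates the condition at exactly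
    one of the [n - s] places; the pairs (place, word) are counted in both orders. *)
Lemma card_canon_words n s m : (s <= n)%N -> (m <= n)%N ->
  (#|canon_words n s m| + (n - s) * defect n m = surj 1 n m)%N.
Proof.
move=> le_sn le_mn; rewrite -[in RHS](@card_below n m) // -card_words.
rewrite -[RHS](cardsID [set w : word n | canon s w]); congr addn.
  by apply: eq_card => w; rewrite !inE.
have -> : (n - s = #|[pred i : 'I_n | (s <= i)%N]|)%N.
  have := cardsC (below n s); rewrite card_below // card_ord => def_n.
  transitivity #|~: below n s|; first by lia.
  by apply: eq_card => i; rewrite !inE -leqNgt.
rewrite -sum_nat_const.
rewrite (eq_bigr (fun i : 'I_n => \sum_(w : word n |
  (levels w == below n m) && (lone w i && ~~ positive (w i))) 1))%N; last first.
  by move=> i _; rewrite sum1dep_card card_lone.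
rewrite (exchange_big_dep (fun w => levels w == below n m)) /=; last first.
  by move=> i w _ /andP[].
rewrite -sum1_card [RHS]big_mkcond [LHS]big_mkcond /=.
apply: eq_bigr => w _; rewrite !inE; case: eqP => _; last by rewrite andbF.
rewrite andbT sum1_card; case: ifPn => [/forallPn[i]|/negPn/forallP can].
  rewrite negb_imply => /andP[/andP[le_si loni] posi].
  rewrite (eq_card (B := pred1 i)) ?card1 // => j; rewrite [LHS]unfold_in /= !inE.
  apply/idP/eqP => [/and3P[_ lonj _]|->]; last by rewrite le_si loni posi.
  exact: (lone_inj lonj loni).
apply: eq_card0 => i; rewrite unfold_in /= inE; apply/negP => /and3P[le_si loni].
by have := can i; rewrite le_si loni /= => ->.
Qed.

(** * Cones of an arrangement *)

Import numFieldNormedType.Exports.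
Local Open Scope classical_set_scope.

Definition dot {R : realType} {n : nat} (x v : 'rV[R]_n) : R := (x *m v^T) 0 0.

Lemma dotD {R : realType} {n : nat} (x y v : 'rV[R]_n) :
  dot (x + y) v = dot x v + dot y v.
Proof. by rewrite /dot mulmxDl mxE. Qed.

Lemma dotZ {R : realType} {n : nat} (c : R) (x v : 'rV[R]_n) :
  dot (c *: x) v = c * dot x v.
Proof. by rewrite /dot -scalemxAl mxE. Qed.

Lemma dot_sum {R : realType} {n : nat} (x v : 'rV[R]_n) :
  dot x v = \sum_j v 0 j * x 0 j.
Proof. by rewrite /dot mxE; apply: eq_bigr => j _; rewrite mxE mulrC. Qed.

Lemma continuous_dot {R : realType} {n : nat} (v : 'rV[R]_n) :
  continuous (fun x : 'rV[R]_n => dot x v).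
Proof.
have -> : (fun x : 'rV[R]_n => dot x v) =
    (fun x => \sum_(j <- index_enum 'I_n | true) v 0 j * x 0 j).
  by apply/boolp.funext => x; rewrite dot_sum.
refine (continuous_big (@add_continuous R^o) _) => j _ x.
apply: (continuous_comp (f := fun y : 'rV[R]_n => y 0 j)).
  exact: coord_continuous.
exact: mulrl_continuous.
Qed.

(** The closed cone with [x] in its relative interior, given by signs: at each normal, [y] vanishes
    or has the sign of [x]. *)
Definition face {R : realType} {n : nat} (A : arrangement R n) (x : 'rV[R]_n) :
    set 'rV[R]_n :=
  [set y | forall v, v \in A -> dot y v = 0 \/ 0 < dot x v * dot y v].

Definition regular {R : realType} {n : nat} (A : arrangement R n) (x : 'rV[R]_n) :=
  forall v, v \in A -> dot x v != 0.

Lemma arr_complementP {R : realType} {n : nat} (A : arrangement R n) x :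
  arr_complement A x <-> regular A x.
Proof.
split=> [cx v vA|rx [v vA xv]]; last by have /eqP := rx v vA; apply.
by apply/eqP => xv; apply: cx; exists v.
Qed.

(** A sign change on a connected set forces a zero of [dot _ v]; conversely, the segment between two
    points with the same nonzero signs avoids every hyperplane. *)
Lemma component_complement {R : realType} {n : nat} (A : arrangement R n) x :
  regular A x ->
  connected_component (arr_complement A) x =
  [set y | forall v, v \in A -> 0 < dot x v * dot y v].
Proof.
move=> rx; apply/seteqP; split => [y [C [Cx CA connC] Cy] v vA|y xy].
  have [//|le0] := ltP 0 (dot x v * dot y v).
  have [z Cz z0] : [set dot z v | z in C] 0.
    have intC : is_interval [set dot z v | z in C].
      apply/connected_intervalP/connected_continuous_connected => //.
      exact/continuous_subspaceT/continuous_dot.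
    have Ix : [set dot z v | z in C] (dot x v) by exists x.
    have Iy : [set dot z v | z in C] (dot y v) by exists y.
    have [x0|x0] := leP (dot x v) 0; have [y0|y0] := leP (dot y v) 0.
    - have : dot x v * dot y v != 0.
        by have /arr_complementP ry := CA _ Cy; rewrite mulf_neq0 ?rx ?ry.
      nra.
    - by apply: (intC _ _ Ix Iy); rewrite x0 ltW.
    - by apply: (intC _ _ Iy Ix); rewrite y0 ltW.
    - by exfalso; nra.
  by have /arr_complementP/(_ v vA) := CA _ Cz; rewrite z0 eqxx.
pose f (t : R) := x + t *: (y - x).
have fE t v : dot (f t) v = dot x v + t * (dot y v - dot x v).
  by rewrite dotD dotZ dotD -scaleN1r dotZ mulN1r.
have : [set f t | t in `[0, 1]] `<=` connected_component (arr_complement A) x.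
  apply: connected_component_max.
  - by exists 0; rewrite ?/f ?scale0r ?addr0 //= in_itv /= lexx ler01.
  - move=> _ [t /= + <-]; rewrite in_itv /= => /andP[t0 t1].
    apply/arr_complementP => v vA; have := xy v vA; have := rx v vA.
    rewrite fE => xv xyv; apply/eqP => e0.
    have : 0 < dot x v ^+ 2 by rewrite exprn_even_gt0.
    (* Multiplied by [dot x v], the value at [f t] is a convex combination of two positive
       numbers. *)
    have : dot x v ^+ 2 * (1 - t) + t * (dot x v * dot y v) = 0.
      by have := congr1 (fun u => dot x v * u) e0; rewrite mulr0 => <-; ring.
    have [->|] := eqVneq t 0; first by nra.
    move=> tn0; have : 0 < t by rewrite lt_neqAle eq_sym tn0.
    by nra.
  - apply: connected_continuous_connected; first exact: segment_connected.
    apply: continuous_subspaceT => t; apply: cvgD; first exact: cvg_cst.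
    by apply: cvgZr_tmp; exact: cvg_id.
apply; exists 1; first by rewrite /= in_itv /= lexx ler01.
by rewrite /f scale1r addrC subrK.
Qed.

(** Weak inequalities pass to the closure, and [dot x v != 0] turns equality into [dot y v = 0].
    Conversely, [y + t x] lies in the component for [t > 0] and tends to [y]. *)
Lemma closure_component {R : realType} {n : nat} (A : arrangement R n) x :
  regular A x ->
  closure (connected_component (arr_complement A) x) = face A x.
Proof.
move=> rx; rewrite component_complement //; apply/seteqP; split => [y cy v vA|y xy B].
  have : closure [set y | 0 <= dot x v * dot y v] y.
    by apply: closure_subset cy => z /(_ v vA)/ltW.
  have clo : closed [set y | 0 <= dot x v * dot y v].
    apply: (@preimage_closed _ _ (fun y => dot x v * dot y v) [set r | 0 <= r]).
      move=> z _; apply: (continuous_comp (f := fun y => dot y v)).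
        exact: continuous_dot.
      exact: mulrl_continuous.
    exact: closed_ge.
  rewrite -(closure_id _).1 //= le_eqVlt => /orP[|]; last by right.
  by rewrite eq_sym mulf_eq0 (negbTE (rx v vA)) => /eqP; left.
move=> nB; pose f (t : R) := y + t *: x.
have cf : {for 0, continuous f}.
  apply: cvgD; first exact: cvg_cst.
  by apply: cvgZr_tmp; exact: cvg_id.
have : nbhs (f 0) B by rewrite /f scale0r addr0.
move=> /cf/nbhs_ballP[e /= e0 eB].
exists (f (e / 2)); split => /=.
  move=> v vA; rewrite dotD dotZ mulrDr mulrCA -expr2.
  have x0 : 0 < dot x v ^+ 2 by rewrite exprn_even_gt0 ?rx.
  by have [->|xyv] := xy v vA; rewrite ?mulr0 ?add0r ?addr_gt0 // mulr_gt0 // divr_gt0.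
apply: eB; rewrite /ball /= sub0r normrN ger0_norm ?divr_ge0 ?ltW //.
by lra.
Qed.

Lemma mulr_gt0_trans {R : realFieldType} (b a c : R) :
  0 < a * b -> 0 < b * c -> 0 < a * c.
Proof.
move=> ab bc; have b2 : 0 < b ^+ 2.
  by rewrite exprn_even_gt0 //; apply/eqP => b0; move: ab; rewrite b0 mulr0 ltxx.
rewrite -(pmulr_rgt0 _ b2); have -> : b ^+ 2 * (a * c) = (a * b) * (b * c) by ring.
exact: mulr_gt0.
Qed.

Lemma dot0 {R : realType} {n : nat} (v : 'rV[R]_n) : dot 0 v = 0.
Proof. by rewrite -(scale0r (0 : 'rV[R]_n)) dotZ mul0r. Qed.

Lemma chambersE {R : realType} {n : nat} (A : arrangement R n) :
  chambers A = [set face A x | x in [set x | regular A x]].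
Proof.
apply/seteqP; split=> c [x] /=.
  by move=> /arr_complementP rx <-; exists x; rewrite ?closure_component.
by move=> rx <-; exists x; [apply/arr_complementP | rewrite closure_component].
Qed.

Lemma face_refl {R : realType} {n : nat} (A : arrangement R n) x : face A x x.
Proof.
move=> v _; have [->|xv] := eqVneq (dot x v) 0; first by left.
by right; rewrite -expr2 exprn_even_gt0.
Qed.

Lemma face0 {R : realType} {n : nat} (A : arrangement R n) x : face A x 0.
Proof. by move=> v _; left; rewrite dot0. Qed.

Lemma faceD {R : realType} {n : nat} (A : arrangement R n) x y z :
  face A x y -> face A x z -> face A x (y + z).
Proof.
move=> fy fz v vA; rewrite dotD mulrDr.
have [->|yv] := fy v vA; first by rewrite mulr0 !add0r; apply: fz.
by right; have [->|zv] := fz v vA; rewrite ?mulr0 ?addr0 // addr_gt0.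
Qed.

Lemma face_add_neq0 {R : realType} {n : nat} (A : arrangement R n) x y z v :
  v \in A -> face A x y -> face A x z ->
  (dot y v != 0) || (dot z v != 0) -> dot (y + z) v != 0.
Proof.
move=> vA fy fz; rewrite dotD.
have [->|yv] := fy v vA; first by rewrite eqxx add0r.
have [->|zv] := fz v vA; first by rewrite eqxx orbF addr0.
move=> _; apply/eqP => yz0; have := addr_gt0 yv zv.
by rewrite -mulrDr yz0 mulr0 ltxx.
Qed.

(** Signs cannot cancel inside one chamber, so adding points of the cone gives a point [x] that is
    nonzero at every normal where some point of the cone is. The cone is the face of this [x]. *)
Lemma cone_face {R : realType} {n : nat} (A : arrangement R n) c :
  cones A c -> exists x, c = face A x.
Proof.
move=> [F [[C0 FC0] FA] <-] {c}; set c := \bigcap_(C in F) C.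
have faceF C : F C -> exists z, C = face A z.
  by move=> /FA; rewrite chambersE => -[z _ <-]; exists z.
have cD y z : c y -> c z -> c (y + z).
  move=> cy cz C FC; have [u Cu] := faceF C FC; have := cz C FC; have := cy C FC.
  rewrite Cu; exact: faceD.
have [x0 C0E] := faceF C0 FC0.
have [x cx gen_x] : exists2 x, c x &
    forall v, v \in A -> (exists2 y, c y & dot y v != 0) -> dot x v != 0.
  (* The induction runs over a sublist of the normals, while faces stay relative to all of [A]. *)
  have : {subset A <= A} by [].
  elim: {1 3}A => [_|u A' IH sub].
    by exists 0 => // C /faceF[z ->]; apply: face0.
  have [|x cx gen_x] := IH; first by move=> v vA'; apply: sub; rewrite inE vA' orbT.
  have [[y cy yu]|noy] := pselect (exists2 y, c y & dot y u != 0); last first.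
    exists x => // v; rewrite inE => /orP[/eqP ->|]; last exact: gen_x.
    by move/noy.
  have fx : face A x0 x by rewrite -C0E; apply: cx.
  have fy : face A x0 y by rewrite -C0E; apply: cy.
  exists (x + y) => [|v v_in ev]; first exact: cD.
  apply: face_add_neq0 fx fy _; first exact: sub.
  move: v_in; rewrite inE => /orP[/eqP ->|vA']; first by rewrite yu orbT.
  by rewrite gen_x.
exists x; apply/seteqP; split => [y cy v vA|y xy C FC].
  have := cx _ FC0; have := cy _ FC0; rewrite C0E.
  move=> /(_ v vA) [->|yv] /(_ v vA) [xv|xv]; [by left|by left| |].
    left; apply: contra_eq xv => yv0; apply: gen_x => //.
    by exists y.
  by right; apply: mulr_gt0_trans yv; rewrite mulrC.
have [z Cz] := faceF C FC; have := cx C FC; rewrite Cz => zx v vA.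
have [yv|xyv] := xy v vA; first by left.
have [xv|zxv] := zx v vA; first by move: xyv; rewrite xv mul0r ltxx.
by right; apply: mulr_gt0_trans xyv.
Qed.

Lemma large_multiple {R : realType} {n : nat} (A : arrangement R n) (x g : 'rV[R]_n) :
  exists T : R, forall t, T <= t -> forall v, v \in A -> dot x v != 0 ->
    0 < dot x v * dot (t *: x + g) v.
Proof.
elim: A => [|u A [T HT]]; first by exists 0.
(* This bound makes [t + dot g u / dot x u] at least 1. *)
exists (Num.max T (1 - dot g u / dot x u)) => t.
rewrite ge_max => /andP[/HT {}HT le_t] v; rewrite inE => /orP[/eqP ->|/HT//] xu.
rewrite dotD dotZ; have x2 : 0 < dot x u ^+ 2 by rewrite exprn_even_gt0.
have -> : dot x u * (t * dot x u + dot g u) =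
          dot x u ^+ 2 * (t + dot g u / dot x u) by field.
by rewrite mulr_gt0 //; lra.
Qed.

(** The face is the intersection of the chambers of [t x + g] and [t x - g] for large [t]: both have
    the sign of [x] where [x] is nonzero, and they have opposite signs where [x] vanishes. *)
Lemma face_cone {R : realType} {n : nat} (A : arrangement R n) (g x : 'rV[R]_n) :
  regular A g -> cones A (face A x).
Proof.
move=> rg; have [T1 H1] := large_multiple A x g.
have [T2 H2] := large_multiple A x (- g).
pose t := Num.max T1 T2.
have {}H1 : forall v, v \in A -> dot x v != 0 -> 0 < dot x v * dot (t *: x + g) v.
  by apply: H1; rewrite le_max lexx.
have {}H2 : forall v, v \in A -> dot x v != 0 -> 0 < dot x v * dot (t *: x - g) v.
  by apply: H2; rewrite le_max lexx orbT.
have dN v : dot (- g) v = - dot g v by rewrite -scaleN1r dotZ mulN1r.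
have reg y : (forall v, v \in A -> dot x v != 0 -> 0 < dot x v * dot y v) ->
    (forall v, v \in A -> dot x v = 0 -> dot y v != 0) -> regular A y.
  move=> Hn H0 v vA; have [x0|xn] := eqVneq (dot x v) 0; first exact: H0.
  by apply/eqP => y0; have := Hn v vA xn; rewrite y0 mulr0 ltxx.
exists [set face A (t *: x + g); face A (t *: x - g)].
  split; first by exists (face A (t *: x + g)); left.
  rewrite chambersE => C [|] ->.
    exists (t *: x + g) => //=; apply: reg => // v vA x0.
    by rewrite dotD dotZ x0 mulr0 add0r rg.
  exists (t *: x - g) => //=; apply: reg => // v vA x0.
  by rewrite dotD dotZ dN x0 mulr0 add0r oppr_eq0 rg.
apply/seteqP; split => [y fy v vA|y xy C CE].
  have := fy _ (or_introl erefl) v vA; have := fy _ (or_intror erefl) v vA.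
  case=> [y0|y2] [y0'|y1]; [by left|by left|by left|].
  have [x0|xn] := eqVneq (dot x v) 0.
    by move: y1 y2; rewrite !dotD !dotZ dN x0 mulr0 !add0r mulNr; lra.
  by right; apply: mulr_gt0_trans y1; apply: H1.
have xn v : 0 < dot x v * dot y v -> dot x v != 0.
  by move=> xyv; apply/eqP => x0; move: xyv; rewrite x0 mul0r ltxx.
case: CE => -> v vA; have [->|xyv] := xy v vA; (try by left); right;
  apply: mulr_gt0_trans (xyv); rewrite mulrC.
  by apply: H1; rewrite ?xn.
by apply: H2; rewrite ?xn.
Qed.

Lemma face_eq_sg {R : realType} {n : nat} (A : arrangement R n) x y :
  face A x = face A y <->
  (forall v, v \in A -> Num.sg (dot x v) = Num.sg (dot y v)).
Proof.
have sgP (a b : R) : 0 < a * b -> Num.sg a = Num.sg b.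
  case: (ltrgt0P a) => [a0|a0|->]; rewrite ?mul0r ?ltxx //.
    by rewrite pmulr_rgt0 // => b0; rewrite !gtr0_sg.
  by rewrite nmulr_rgt0 // => b0; rewrite !ltr0_sg.
split=> [eq_xy v vA|eq_sg].
  have : face A y x by rewrite -eq_xy; apply: face_refl.
  have : face A x y by rewrite eq_xy; apply: face_refl.
  move=> /(_ v vA) xy /(_ v vA) yx; case: xy yx => [-> [->//|]|/sgP//].
  by rewrite mul0r ltxx.
apply/seteqP; split=> z fz v vA; have [|xz] := fz v vA; [by left| |by left|];
  right; rewrite -sgr_gt0 sgrM ?eq_sg -?sgrM ?sgr_gt0 //.
by rewrite -sgr_gt0 sgrM -eq_sg // -sgrM sgr_gt0.
Qed.

(** * Dimension of a face *)

Lemma cone_dim_uniq {R : realType} {n : nat} (c : set 'rV[R]_n) m m' :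
  cone_dim c m -> cone_dim c m' -> m = m'.
Proof.
move=> [B [freeB Bc cB]] [B' [freeB' B'c cB']].
rewrite -(eqP freeB) -(eqP freeB'); apply/eqP; rewrite eqn_leq.
by apply/andP; split; apply/mxrankS/row_subP => i; [apply: cB' | apply: cB].
Qed.

(** Adding a large multiple of [x] moves any vector of the space spanned by [B] into the face, so
    the face spans that space. *)
Lemma face_dim {R : realType} {n : nat} (A : arrangement R n) x m (B : 'M[R]_(m, n)) :
  row_free B ->
  (forall y : 'rV_n, (y <= B)%MS <->
     (forall v, v \in A -> dot x v = 0 -> dot y v = 0)) ->
  cone_dim (face A x) m.
Proof.
move=> freeB spanB.
have /boolp.choice[t Ht] : forall i : 'I_m, exists t : R, forall v, v \in A ->
    dot x v != 0 -> 0 < dot x v * dot (t *: x + row i B) v.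
  by move=> i; have [T HT] := large_multiple A x (row i B); exists T; apply: HT.
have xB : (x <= B)%MS by apply/spanB.
(* With [x] as a row, the rows of [B] are recovered by subtraction. The [m + 1] rows of [G] have
   rank [m], and [maxrankfun] extracts a basis from them. *)
pose G := col_mx x (\matrix_i (t i *: x + row i B)).
have GB : (G :=: B)%MS.
  apply/eqmxP; rewrite col_mx_sub xB /=; apply/andP; split.
    apply/row_subP => i; rewrite rowK; apply: addmx_sub; last exact: row_sub.
    exact: scalemx_sub.
  apply/row_subP => i.
  have -> : row i B = (t i *: x + row i B) - t i *: x by rewrite addrC addKr.
  apply: addmx_sub; last first.
    rewrite eqmx_opp; apply: scalemx_sub.
    by rewrite /G -addsmxE addsmxSl.
  rewrite /G -addsmxE; apply: submx_trans (addsmxSr _ _).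
  by rewrite -(rowK (fun i => t i *: x + row i B)) row_sub.
have <- : \rank G = m by rewrite GB; apply/eqP.
exists (rowsub (maxrankfun G) G); split; first exact: maxrowsub_free.
  move=> i; rewrite row_rowsub.
  case: (split_ordP (maxrankfun G i)) => j ->; rewrite ?rowKu ?rowKd.
    by rewrite row_id ?ord1; apply: face_refl.
  rewrite rowK => v vA; have [x0|xn] := eqVneq (dot x v) 0; last by right; apply: Ht.
  left; rewrite dotD dotZ x0 mulr0 add0r.
  by move: (row_sub j B) => /spanB; apply.
move=> y fy; rewrite eq_maxrowsub GB; apply/spanB => v vA x0.
by have [//|] := fy v vA; rewrite x0 mul0r ltxx.
Qed.

(** * The cones of D_{n,s} *)

Lemma sgr_addE {R : realDomainType} (p q : R) :
  0 <= p * q -> Num.sg (p + q) = if p == 0 then Num.sg q else Num.sg p.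
Proof.
case: (ltrgt0P p) => [p0|p0|->]; last by rewrite add0r.
  by rewrite pmulr_rge0 // => q0; rewrite !gtr0_sg // ltr_wpDr.
by rewrite nmulr_rge0 // => q0; rewrite !ltr0_sg // ltr_wnDr.
Qed.

Lemma ler_norm_mul {R : realDomainType} (a b : R) :
  (`|b| <= `|a|) = (0 <= (a + b) * (a - b)).
Proof.
rewrite -ler_sqr ?nnegrE ?normr_ge0 // !real_normK ?num_real //.
by rewrite mulrC -subr_sqr subr_ge0.
Qed.

Lemma sgr_ge0E {R : realDomainType} (a b : R) :
  Num.sg a = Num.sg b -> (0 <= a) = (0 <= b).
Proof. by move=> eq_sg; rewrite -sgr_ge0 eq_sg sgr_ge0. Qed.

(** The order of two absolute values is the sign of [(a + b) (a - b)], hence visible from the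
    normals [e_i + e_j] and [e_i - e_j]. *)
Lemma ler_norm_sg {R : realDomainType} (a b a' b' : R) :
  Num.sg (a + b) = Num.sg (a' + b') -> Num.sg (a - b) = Num.sg (a' - b') ->
  (`|b| <= `|a|) = (`|b'| <= `|a'|).
Proof.
move=> sD sB; rewrite !ler_norm_mul; apply: sgr_ge0E.
by rewrite !sgrM sD sB.
Qed.

(** In [2 a = (a + b) + (a - b)] the summands do not have opposite signs when [|b| <= |a|]. *)
Lemma sgr_max {R : realFieldType} (a b a' b' : R) :
  Num.sg (a + b) = Num.sg (a' + b') -> Num.sg (a - b) = Num.sg (a' - b') ->
  `|b| <= `|a| -> Num.sg a = Num.sg a'.
Proof.
move=> sD sB le_ba; have le_ba' := le_ba; rewrite (ler_norm_sg sD sB) in le_ba'.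
have sg2 c d : `|d| <= `|c| :> R -> Num.sg c =
    if Num.sg (c + d) == 0 then Num.sg (c - d) else Num.sg (c + d).
  rewrite ler_norm_mul => /sgr_addE; rewrite sgr_eq0 => <-.
  have -> : c + d + (c - d) = 2 * c by ring.
  by rewrite sgrM (gtr0_sg (ltr0Sn R 1)) mul1r.
by rewrite (sg2 _ _ le_ba) (sg2 _ _ le_ba') sD sB.
Qed.

Lemma sgr_addl {R : realFieldType} (a b : R) : `|a| < `|b| -> Num.sg (a + b) = Num.sg b.
Proof.
have [b0|b0|->] := ltrgt0P b; last by rewrite ltNge normr_ge0.
  by rewrite ltr_norml => /andP[lt_ba _]; rewrite !gtr0_sg //; lra.
by rewrite ltr_norml => /andP[_ lt_ab]; rewrite !ltr0_sg //; lra.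
Qed.

Lemma sgr_addr {R : realFieldType} (a b : R) : `|b| < `|a| -> Num.sg (a + b) = Num.sg a.
Proof. by rewrite addrC; apply: sgr_addl. Qed.

(** The entry of larger absolute value decides the sign of the sum; for equal absolute values the
    sum is [(sg a + sg b) |b|]. *)
Lemma sgr_add_sg {R : realFieldType} (a b a' b' : R) :
  Num.sg a = Num.sg a' -> Num.sg b = Num.sg b' ->
  (`|a| < `|b|) = (`|a'| < `|b'|) -> (`|b| < `|a|) = (`|b'| < `|a'|) ->
  Num.sg (a + b) = Num.sg (a' + b').
Proof.
move=> sa sb lt_ab lt_ba.
have [lt|lt|eq] := ltrgtP `|a| `|b|.
- by rewrite !sgr_addl -?lt_ab.
- by rewrite !sgr_addr -?lt_ba.
have eq' : `|a'| = `|b'|.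
  by apply/eqP; rewrite eq_le !leNgt -lt_ab -lt_ba eq ltxx.
rewrite (numEsg a) (numEsg b) (numEsg a') (numEsg b') eq eq' sa sb -!mulrDl.
by rewrite !sgrM !sgr_norm -(sgr_eq0 b) sb sgr_eq0.
Qed.

(** * Evaluation on the normals of D_{n,s} *)

Lemma dotDr {R : realType} {n : nat} (x u v : 'rV[R]_n) :
  dot x (u + v) = dot x u + dot x v.
Proof. by rewrite /dot linearD /= mulmxDr mxE. Qed.

Lemma dotNr {R : realType} {n : nat} (x v : 'rV[R]_n) : dot x (- v) = - dot x v.
Proof. by rewrite /dot linearN /= mulmxN mxE. Qed.

Lemma dot_delta {R : realType} {n : nat} (x : 'rV[R]_n) i :
  dot x (delta_mx 0 i) = x 0 i.
Proof.
rewrite dot_sum (bigD1 i) //= mxE !eqxx mul1r big1 ?addr0 // => j neq_ji.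
by rewrite mxE (negbTE neq_ji) andbF mul0r.
Qed.

Lemma arrDP {R : realType} {n s : nat} (v : 'rV[R]_n) :
  v \in arrD R n s <->
  [\/ exists i j : 'I_n, (i < j)%N /\ v = delta_mx 0 i + delta_mx 0 j,
      exists i j : 'I_n, (i < j)%N /\ v = delta_mx 0 i - delta_mx 0 j
    | exists i : 'I_n, (i < s)%N /\ v = delta_mx 0 i].
Proof.
rewrite /arrD !mem_cat; split.
  case/or3P => /mapP[p]; rewrite mem_enum inE => lt ->.
  - by apply: Or31; exists p.1, p.2.
  - by apply: Or32; exists p.1, p.2.
  - by apply: Or33; exists p.
case=> [[i [j [lt ->]]]|[i [j [lt ->]]]|[i [lt ->]]]; apply/or3P.
- by apply/Or31/mapP; exists (i, j); rewrite // mem_enum inE.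
- by apply/Or32/mapP; exists (i, j); rewrite // mem_enum inE.
- by apply/Or33/mapP; exists i; rewrite // mem_enum inE.
Qed.

(** Invariance under joint negation makes [e_i - e_j] and [e_j - e_i] interchangeable, so [i < j]
    relaxes to [i != j]. *)
Lemma arrD_forall {R : realType} {n s : nat} (x y : 'rV[R]_n) (P : R -> R -> Prop) :
  (forall a b, P a b <-> P (- a) (- b)) ->
  (forall v, v \in arrD R n s -> P (dot x v) (dot y v)) <->
  (forall i j : 'I_n, i != j -> P (x 0 i + x 0 j) (y 0 i + y 0 j) /\
                                P (x 0 i - x 0 j) (y 0 i - y 0 j)) /\
  (forall i : 'I_n, (i < s)%N -> P (x 0 i) (y 0 i)).
Proof.
move=> PN; split=> [H|[Hij Hi] v].
  split=> [i j|i lt_is]; last first.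
    by rewrite -!dot_delta; apply/H/arrDP/Or33; exists i.
  wlog lt_ij : i j / (i < j)%N => [th|_].
    rewrite -(inj_eq val_inj) neq_ltn => /orP[] lt_ij.
      by apply: th => //; rewrite -(inj_eq val_inj) neq_ltn lt_ij.
    have [] := th j i lt_ij; first by rewrite -(inj_eq val_inj) neq_ltn lt_ij.
    rewrite (addrC (x 0 j)) (addrC (y 0 j)) => ? /PN.
    by rewrite !opprB.
  split; rewrite -!dot_delta -?dotNr -!dotDr; apply/H/arrDP.
    by apply: Or31; exists i, j.
  by apply: Or32; exists i, j.
have neq (i j : 'I_n) : (i < j)%N -> i != j.
  by rewrite -(inj_eq val_inj) neq_ltn => ->.
move=> /arrDP[[i [j [/neq/Hij[? ?] ->]]]|[i [j [/neq/Hij[? ?] ->]]]|[i [lt ->]]];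
  rewrite ?dotDr ?dotNr !dot_delta //.
exact: Hi.
Qed.

Definition same_signs {R : realType} {n : nat} (s : nat) (x y : 'rV[R]_n) : Prop :=
  (forall i j : 'I_n, i != j -> Num.sg (x 0 i + x 0 j) = Num.sg (y 0 i + y 0 j) /\
                                Num.sg (x 0 i - x 0 j) = Num.sg (y 0 i - y 0 j)) /\
  (forall i : 'I_n, (i < s)%N -> Num.sg (x 0 i) = Num.sg (y 0 i)).

Lemma faceD_eqP {R : realType} {n s : nat} (x y : 'rV[R]_n) :
  face (arrD R n s) x = face (arrD R n s) y <-> same_signs s x y.
Proof.
apply: (iff_trans (face_eq_sg _ _ _)).
apply: (@arrD_forall _ _ _ _ _ (fun a b => Num.sg a = Num.sg b)) => a b.
by rewrite !sgrN; split=> [->|/oppr_inj].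
Qed.

(** The coordinates [1..n] are positive and distinct. This is the regular point that [face_cone]
    requires. *)
Lemma regular_arrD {R : realType} {n s : nat} :
  regular (arrD R n s) (\row_i i.+1%:R).
Proof.
apply/(@arrD_forall _ _ _ _ (\row_i i.+1%:R) (fun a _ => is_true (a != 0))).
  by move=> a _; rewrite oppr_eq0.
split=> [i j neq_ij|i _]; rewrite !mxE; last by rewrite pnatr_eq0.
split; last by rewrite subr_eq0 eqr_nat eqSS.
by rewrite -(natrD R i.+1 j.+1) pnatr_eq0.
Qed.

Lemma arr_rank_arrD (R : realType) (n s : nat) :
  (2 <= n)%N -> arr_rank (arrD R n s) = n.
Proof.
move=> n2; rewrite /arr_rank.
suff -> : <<arrD R n s>>%VS = fullv by rewrite dimvf /dim /= mul1n.
set V := <<_>>%VS.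
have memV (i j : 'I_n) : (i < j)%N ->
    (delta_mx 0 i : 'rV[R]_n) \in V /\ (delta_mx 0 j : 'rV[R]_n) \in V.
  move=> lt_ij.
  have VD : delta_mx 0 i + delta_mx 0 j \in V.
    by apply/memv_span/arrDP/Or31; exists i, j.
  have VB : delta_mx 0 i - delta_mx 0 j \in V.
    by apply/memv_span/arrDP/Or32; exists i, j.
  have V2 (u : 'rV[R]_n) : 2%:R *: u \in V -> u \in V.
    have nz2 : 2%:R != 0 :> R by rewrite pnatr_eq0.
    by move=> /(memvZ 2%:R^-1); rewrite scalerK.
  split; apply: V2; rewrite scaler_nat.
    suff -> : delta_mx 0 i *+ 2 =
        (delta_mx 0 i + delta_mx 0 j) + (delta_mx 0 i - delta_mx 0 j) :> 'rV[R]_n.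
      exact: memvD.
    by rewrite addrACA subrr addr0 mulr2n.
  suff -> : delta_mx 0 j *+ 2 =
      (delta_mx 0 i + delta_mx 0 j) - (delta_mx 0 i - delta_mx 0 j) :> 'rV[R]_n.
    exact: memvB.
  by rewrite opprB addrC addrA subrK mulr2n.
apply/eqP; rewrite eqEsubv subvf /=; apply/subvP => x _.
rewrite (row_sum_delta x); apply: memv_suml => i _; apply: memvZ.
have n0 : (0 < n)%N by lia.
(* The index 0 is paired with 1, which exists as [2 <= n], and every other index with 0. *)
have [i0|i0] := posnP i.
  by have [] := memV i (Ordinal n2) _; rewrite /= ?i0.
by have [] := memV (Ordinal n0) i i0.
Qed.

(** * Words as representatives of the sign vectors *)

Definition letter_val (R : realType) {n : nat} (v : letter n) : R :=
  if v is Some (b, a) then (-1) ^+ b * a.+1%:R else 0.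

Definition point (R : realType) {n : nat} (w : word n) : 'rV[R]_n :=
  \row_i letter_val R (w i).

Lemma norm_letter_val {R : realType} {n : nat} (v : letter n) :
  `|letter_val R v| = (amp v)%:R.
Proof.
by case: v => [[b a]|] /=; rewrite ?normr0 // normrM normr_sign mul1r normr_nat.
Qed.

Lemma sg_letter_val {R : realType} {n : nat} (v : letter n) :
  Num.sg (letter_val R v) = if v is Some (b, _) then (-1) ^+ b else 0.
Proof.
case: v => [[b a]|] /=; last by rewrite sgr0.
by rewrite sgrM (gtr0_sg (ltr0Sn R a)) mulr1; case: b; rewrite ?sgrN sgr1.
Qed.

Lemma letter_eq {R : realType} {n : nat} (v v' : letter n) : amp v = amp v' ->
  Num.sg (letter_val R v) = Num.sg (letter_val R v') -> v = v'.
Proof.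
rewrite !sg_letter_val; case: v v' => [[b a]|] [[b' a']|] //= [/val_inj ->].
by move/signr_inj ->.
Qed.

Lemma amp_eq0 {n : nat} (v : letter n) : (amp v == 0%N) = (v == None).
Proof. by case: v => [[]|]. Qed.

(* An interval of levels has no gaps, so the value of a letter is at most its
   value in any word with the same relative order. *)
Lemma amp_le {n m : nat} (w w' : word n) : levels w = below n m ->
  (forall i j, (amp (w i) < amp (w j))%N -> (amp (w' i) < amp (w' j))%N) ->
  (forall i, w' i = None -> w i = None) ->
  forall i, (amp (w i) <= amp (w' i))%N.
Proof.
move=> lw mono w0 i; move: {2}(amp (w i)) (erefl (amp (w i))) => a.
elim: a i => [|a IH] i ai; first by rewrite ai.
rewrite ai; case: (posnP a) => [->|a0].
  by rewrite lt0n amp_eq0; apply/eqP => /w0 wi; move: ai; rewrite wi.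
(* The ordinal [a.-1] encodes the absolute value [a], which [w] attains because its levels have no
   gaps. *)
have [c [ca cw]] : exists c : 'I_n, val c = a.-1 /\ c \in levels w.
  case wi: (w i) ai => [[b d]|] //= [da].
  have lt_an : (a.-1 < n)%N by move: (ltn_ord d); lia.
  exists (Ordinal lt_an); split=> //; rewrite lw inE /=.
  have : d \in levels w by apply/levelsP; exists i, b.
  by rewrite lw inE; lia.
have [j [b wj]] := levelsP _ _ cw.
have aj : amp (w j) = a by rewrite wj /= ca; lia.
have := IH j aj; rewrite aj => le_a; apply: leq_ltn_trans le_a _.
by apply: mono; rewrite aj ai.
Qed.

(** The normals show the order of the absolute values and the sign of every entry that is not the
    strict minimum. The sign of the strict minimum comes from [e_i] if [i < s], and from canonicity
    otherwise. Then [amp_le] applies in both directions. *)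
Lemma canon_inj {R : realType} {n s m m' : nat} (w w' : word n) :
  levels w = below n m -> levels w' = below n m' -> canon s w -> canon s w' ->
  same_signs s (point R w) (point R w') -> w = w'.
Proof.
move=> lw lw' /forallP cw /forallP cw' [Sij Si].
have ampE i j : i != j -> (amp (w j) <= amp (w i))%N = (amp (w' j) <= amp (w' i))%N.
  move=> /Sij[]; rewrite !mxE => sD sB.
  by have := ler_norm_sg sD sB; rewrite !norm_letter_val !ler_nat.
have ampL i j : (amp (w i) < amp (w j))%N = (amp (w' i) < amp (w' j))%N.
  have [->|neq_ij] := eqVneq i j; first by rewrite !ltnn.
  by rewrite !ltnNge ampE.
have sgE i : Num.sg (letter_val R (w i)) = Num.sg (letter_val R (w' i)).
  have [lonw|] := boolP (lone w i); last first.
    case/forallPn => j; rewrite negb_imply -leqNgt => /andP[neq_ji le_ji].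
    have [] := Sij i j; first by rewrite eq_sym.
    rewrite !mxE => sD sB; apply: sgr_max sD sB _.
    by rewrite !norm_letter_val ler_nat.
  have lonw' : lone w' i.
    by apply/loneP => j /(loneP _ _ lonw); rewrite ampL.
  have [lt_is|le_si] := ltnP i s; first by have := Si i lt_is; rewrite !mxE.
  have := cw i; have := cw' i; rewrite le_si lonw lonw' /= !sg_letter_val.
  by case: (w i) (w' i) => [[[] a]|] // [[[] a']|].
have zero (w1 w2 : word n) : (forall i, Num.sg (letter_val R (w1 i)) =
     Num.sg (letter_val R (w2 i))) -> forall i, w2 i = None -> w1 i = None.
  move=> sg12 i w2i; have := sg12 i; rewrite w2i /= sgr0 => /eqP.
  by rewrite sgr_eq0 -normr_eq0 norm_letter_val pnatr_eq0 amp_eq0 => /eqP.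
apply/ffunP => i; apply: (letter_eq (R := R)) => //; apply/eqP.
rewrite eqn_leq (amp_le lw) ?(amp_le lw') //.
- by move=> i0 j; rewrite ampL.
- by apply: zero => j; rewrite sgE.
- by move=> i0 j; rewrite ampL.
- exact: zero.
Qed.

Definition canon_point {R : realType} {n : nat} (s : nat) (x : 'rV[R]_n) : Prop :=
  forall i : 'I_n, (s <= i)%N ->
    (forall j, j != i -> `|x 0 i| < `|x 0 j|) -> 0 < x 0 i.

Lemma exists_pos_lt {R : realFieldType} {T : eqType} (f : T -> R) (t : seq T) :
  (forall j, j \in t -> 0 < f j) ->
  exists2 r : R, 0 < r & forall j, j \in t -> r < f j.
Proof.
elim: t => [|k t IH] pos; first by exists 1.
have [|r r0 rx] := IH; first by move=> j jt; apply: pos; rewrite inE jt orbT.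
have k0 : 0 < f k by rewrite pos // inE eqxx.
exists (Num.min r (f k / 2)); first by rewrite lt_min r0 divr_gt0.
move=> j; rewrite inE gt_min => /orP[/eqP ->|/rx ->//].
by apply/orP; right; lra.
Qed.

(** A coordinate violating canonicity is replaced by a positive [r] below all other absolute values;
    the other coordinate still decides the sign of every sum and difference. *)
Lemma exists_canon_point {R : realType} {n : nat} (s : nat) (x : 'rV[R]_n) :
  exists2 y, canon_point s y & same_signs s x y.
Proof.
have [cx|] := pselect (canon_point s x); first by exists x.
case/boolp.existsNP => i /boolp.not_implyP[le_si] /boolp.not_implyP[lon _].
have [r r0 rx] : exists2 r : R, 0 < r & forall j, j != i -> r < `|x 0 j|.
  have [|r r0 rx] := @exists_pos_lt _ _ (fun j => `|x 0 j|)
                        [seq j <- enum 'I_n | j != i].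
    move=> j; rewrite mem_filter => /andP[/lon lt_ij _].
    exact: le_lt_trans (normr_ge0 _) lt_ij.
  by exists r => // j neq_ji; apply: rx; rewrite mem_filter neq_ji mem_enum.
exists (\row_j (if j == i then r else x 0 j)).
  (* The new strict minimum sits at [i], so no other [k] can be one. *)
  move=> k le_sk lonk; rewrite !mxE; case: eqVneq => // neq_ki; exfalso.
  have := lonk i; rewrite eq_sym => /(_ neq_ki); rewrite !mxE eqxx (negbTE neq_ki).
  by have := rx k neq_ki; rewrite (gtr0_norm r0); lra.
split=> [j k|j lt_js]; rewrite !mxE; last first.
  by rewrite ifN //; apply: contraTneq lt_js => ->; rewrite -leqNgt.
case: (eqVneq j i) => [-> neq_ik|neq_ji].
  have neq_ki : k != i by rewrite eq_sym.
  rewrite (negbTE neq_ki); split.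
    by rewrite !sgr_addl ?lon // gtr0_norm ?rx.
  by rewrite !sgr_addl ?normrN ?lon // gtr0_norm ?rx.
case: (eqVneq k i) => // -> _; split.
  by rewrite !sgr_addr ?lon // gtr0_norm ?rx.
by rewrite !sgr_addr ?normrN ?lon // gtr0_norm ?rx.
Qed.

(** Each nonzero [|x_i|] is replaced by its rank among the distinct nonzero absolute values, keeping
    the sign. *)
Lemma exists_word {R : realType} {n : nat} (x : 'rV[R]_n) :
  exists w : word n, (exists2 m, (m <= n)%N & levels w = below n m) /\
   (forall i, Num.sg (letter_val R (w i)) = Num.sg (x 0 i)) /\
   (forall i j, (amp (w i) < amp (w j))%N = (`|x 0 i| < `|x 0 j|)).
Proof.
pose t := sort <=%R (undup [seq `|x 0 i| | i <- enum 'I_n & x 0 i != 0]).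
have st : sorted <%R t by rewrite sort_lt_sorted undup_uniq.
have mem_t r : (r \in t) = (r \in [seq `|x 0 i| | i <- enum 'I_n & x 0 i != 0]).
  by rewrite mem_sort mem_undup.
have size_t : (size t <= n)%N.
  rewrite size_sort (leq_trans (size_undup _)) // size_map size_filter.
  by rewrite (leq_trans (count_size _ _)) // size_enum_ord.
have xt i : x 0 i != 0 -> `|x 0 i| \in t.
  by move=> xi; rewrite mem_t; apply: map_f; rewrite mem_filter xi mem_enum.
(* The index is below [size t <= n] whenever [x 0 i != 0], so the default of [insubd] is never
   taken. *)
pose w : word n := [ffun i => if x 0 i == 0 then None
                     else Some (x 0 i < 0, insubd i (index `|x 0 i| t))].
have ampw i : amp (w i) = if x 0 i == 0 then 0%N else (index `|x 0 i| t).+1.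
  rewrite ffunE; case: eqVneq => //= /xt xi; rewrite val_insubd.
  by rewrite (leq_trans _ size_t) // index_mem.
exists w; split; last split.
- exists (size t) => //; apply/setP => a; rewrite [RHS]inE; apply/levelsP/idP.
    case=> i [b]; rewrite ffunE; case: eqVneq => // /xt xi [_ <-].
    by rewrite val_insubd (leq_trans _ size_t) index_mem.
  move=> lt_at; have := mem_nth 0 lt_at; rewrite mem_t => /mapP[i].
  rewrite mem_filter => /andP[xi _] ti; exists i, (x 0 i < 0).
  rewrite ffunE (negbTE xi); congr (Some (_, _)); apply: val_inj.
  rewrite val_insubd -ti index_uniq ?ltn_ord //.
  by move: st; apply: lt_sorted_uniq.
- move=> i; rewrite sg_letter_val ffunE; case: eqVneq => [->|xi]; first by rewrite sgr0.
  have [x0|x0|x0] := ltrgt0P (x 0 i).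
  + by rewrite gtr0_sg.
  + by rewrite ltr0_sg.
  + by rewrite x0 eqxx in xi.
move=> i j; rewrite !ampw.
have [xi|xi] := eqVneq (x 0 i) 0; have [xj|xj] := eqVneq (x 0 j) 0.
- by rewrite xi xj ltnn ltxx.
- by rewrite xi normr0 normr_gt0 xj.
- by rewrite xj normr0 ltNge normr_ge0.
rewrite ltnS -(lt_sorted_ltn_nth 0 st) ?inE ?index_mem ?xt //.
by rewrite !nth_index ?xt.
Qed.

Lemma exists_canon_word {R : realType} {n : nat} (s : nat) (x : 'rV[R]_n) :
  exists m (w : word n),
    [/\ (m <= n)%N, w \in canon_words n s m & same_signs s x (point R w)].
Proof.
have [y cy [xyij xyi]] := exists_canon_point s x.
have [w [[m le_mn lw] [sgw ampw]]] := exists_word y.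
exists m, w; split=> //.
  rewrite inE lw eqxx; apply/forallP => i; apply/implyP => /andP[le_si /loneP lon].
  have : 0 < y 0 i by apply: cy => // j /lon; rewrite ampw.
  have := sgw i; rewrite sg_letter_val => + yi; rewrite (gtr0_sg yi).
  case: (w i) => [[[] a]|] //= e1; last by move/eqP: e1; rewrite eq_sym oner_eq0.
  by have := lt_trans (ltrN10 R) ltr01; rewrite -[-1]expr1 e1 ltxx.
have sgD i j : Num.sg (y 0 i + y 0 j) =
    Num.sg (letter_val R (w i) + letter_val R (w j)).
  by apply: sgr_add_sg; rewrite ?sgw // !norm_letter_val ltr_nat ampw.
have sgB i j : Num.sg (y 0 i - y 0 j) =
    Num.sg (letter_val R (w i) - letter_val R (w j)).
  by apply: sgr_add_sg; rewrite ?sgrN ?sgw // !normrN !norm_letter_val ltr_nat ampw.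
split=> [i j /xyij[sD sB]|i /xyi ->]; rewrite !mxE ?sgw //.
by rewrite sD sB sgD sgB.
Qed.

(** Row [a] is the signed indicator of the places of absolute value [a + 1]; for a canonical word
    these rows form a basis of the span of its face. *)
Definition word_mx (R : realType) {n : nat} (m : nat) (w : word n) : 'M[R]_(m, n) :=
  \matrix_(a < m, i < n)
    if w i is Some (b, c) then (c == a :> nat)%:R * (-1) ^+ b else 0.

Lemma mul_word_mx_None {R : realType} {n m : nat} (w : word n) (D : 'rV[R]_m) j :
  w j = None -> (D *m word_mx R m w) 0 j = 0.
Proof. by move=> wj; rewrite mxE big1 // => a _; rewrite mxE wj mulr0. Qed.

Lemma mul_word_mx_Some {R : realType} {n m : nat} (w : word n) (D : 'rV[R]_m) j b c
    (a : 'I_m) :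
  w j = Some (b, c) -> c = a :> nat -> (D *m word_mx R m w) 0 j = D 0 a * (-1) ^+ b.
Proof.
move=> wj ca; rewrite mxE (bigD1 a) //= mxE wj ca eqxx mul1r big1 ?addr0 //.
move=> a' neq; rewrite mxE wj ca eq_sym -[_ == _]/(a' == a) (negbTE neq).
by rewrite mul0r mulr0.
Qed.

Lemma letter_val_eq0 {R : realType} {n : nat} (v : letter n) :
  letter_val R v = 0 -> v = None.
Proof.
by move/eqP; rewrite -normr_eq0 norm_letter_val pnatr_eq0 amp_eq0 => /eqP.
Qed.

Lemma letter_val_sub0 {R : realType} {n : nat} (v v' : letter n) :
  letter_val R v - letter_val R v' = 0 -> v = v'.
Proof.
move/eqP; rewrite subr_eq0 => /eqP eq_v; apply: (letter_eq (R := R)); last by rewrite eq_v.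
by apply/eqP; rewrite -(eqr_nat R) -!norm_letter_val eq_v.
Qed.

Lemma letter_val_add0 {R : realType} {n : nat} (v v' : letter n) :
  letter_val R v + letter_val R v' = 0 ->
  (v = None /\ v' = None) \/ exists b c, v = Some (b, c) /\ v' = Some (~~ b, c).
Proof.
case: v' => [[b c]|]; last by rewrite addr0 => /letter_val_eq0; left.
move=> add0; right; exists (~~ b), c; rewrite negbK; split=> //.
by apply: (@letter_val_sub0 R); rewrite /= signrN mulNr opprK.
Qed.

Lemma face_point_dim {R : realType} {n s m : nat} (w : word n) :
  (m <= n)%N -> w \in canon_words n s m ->
  cone_dim (face (arrD R n s) (point R w)) m.
Proof.
move=> le_mn; rewrite inE => /andP[/eqP lw /forallP cw].
have lev i b c : w i = Some (b, c) -> (c < m)%N.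
  by move=> wi; have : c \in levels w; [apply/levelsP; exists i, b | rewrite lw inE].
(* For each level, [r] chooses a place where it occurs and the sign there. *)
have /boolp.choice[r Hr] (a : 'I_m) :
    exists ib : 'I_n * bool, w ib.1 = Some (ib.2, widen_ord le_mn a).
  have : widen_ord le_mn a \in levels w by rewrite lw inE /=.
  by case/levelsP => i [b wi]; exists (i, b).
apply: (@face_dim _ _ _ _ _ (word_mx R m w)).
  apply: inj_row_free => D D0; apply/rowP => a; rewrite mxE.
  have := mul_word_mx_Some D (Hr a) (erefl (a : nat)); rewrite D0 mxE => /esym/eqP.
  by rewrite mulf_eq0 signr_eq0 orbF => /eqP.
move=> y.
have PN (a b : R) : (a = 0 -> b = 0) <-> (- a = 0 -> - b = 0).
  split=> H e0; first by rewrite H ?oppr0 // -[a]opprK e0 oppr0.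
  by rewrite -[b]opprK H ?oppr0 // e0 oppr0.
apply: (iff_trans _ (iff_sym (arrD_forall _ _ PN))).
split=> [/submxP[D ->]|[Hij Hi]].
  set z := D *m _.
  split=> [i j _|i _]; rewrite ![point _ _ _ _]mxE; last first.
    move=> /letter_val_eq0 wi; exact: mul_word_mx_None.
  split=> [/letter_val_add0[[wi wj]|[b [c [wi wj]]]]|/letter_val_sub0 eq_w].
  - by rewrite /z !mul_word_mx_None // addr0.
  - rewrite /z (mul_word_mx_Some D (a := Ordinal (lev _ _ _ wi)) wi erefl).
    rewrite (mul_word_mx_Some D (a := Ordinal (lev _ _ _ wi)) wj erefl).
    by rewrite signrN mulrN subrr.
  case wi: (w i) (eq_w) => [[b c]|] /esym wj.
    rewrite /z (mul_word_mx_Some D (a := Ordinal (lev _ _ _ wi)) wi erefl).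
    by rewrite (mul_word_mx_Some D (a := Ordinal (lev _ _ _ wi)) wj erefl) subrr.
  by rewrite /z !mul_word_mx_None // subrr.
(* For [i >= s], canonicity provides a second zero [j]; both [e_i + e_j] and [e_i - e_j] are
   orthogonal to the point, hence to [y]. *)
have y0 i : w i = None -> y 0 i = 0.
  move=> wi; have [lt_is|le_si] := ltnP i s.
    by apply: Hi; rewrite ?mxE ?wi.
  have /forallPn[j] : ~~ lone w i.
    by apply/negP => lon; have := cw i; rewrite le_si lon wi.
  rewrite negb_imply wi -leqNgt leqn0 amp_eq0 => /andP[neq_ji /eqP wj].
  have [] := Hij i j; rewrite 1?eq_sym // !mxE wi wj /= addr0 subr0.
  by move=> /(_ erefl) yD /(_ erefl) yB; lra.
(* Two places of the same level are tied by [e_i - e_j] if their signs agree and by [e_i + e_j] if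
   not. *)
have yE i j b b' c : w i = Some (b, c) -> w j = Some (b', c) ->
    y 0 i * (-1) ^+ b = y 0 j * (-1) ^+ b'.
  move=> wi wj; have [eq_ij|neq_ij] := eqVneq i j.
    by move: wi; rewrite eq_ij wj => -[->].
  have [] := Hij i j neq_ij; rewrite !mxE wi wj /= => yD yB.
  have [eq_bb|neq_bb] := eqVneq b b'.
    move: yB; rewrite eq_bb subrr => /(_ erefl)/eqP.
    by rewrite subr_eq0 => /eqP ->.
  have b'E : b' = ~~ b by case: (b) (b') neq_bb => [] [].
  move: yD; rewrite b'E signrN mulNr subrr => /(_ erefl)/eqP.
  by rewrite addr_eq0 => /eqP ->; rewrite mulNr mulrN.
apply/submxP; exists (\row_a (y 0 (r a).1 * (-1) ^+ (r a).2)).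
apply/rowP => j; case wj: (w j) => [[b c]|]; last first.
  by rewrite mul_word_mx_None // y0.
rewrite (mul_word_mx_Some _ (a := Ordinal (lev _ _ _ wj)) wj erefl) mxE.
have Hc := Hr (Ordinal (lev _ _ _ wj)).
have cE : widen_ord le_mn (Ordinal (lev _ _ _ wj)) = c by apply: val_inj.
rewrite cE in Hc; rewrite (yE _ _ _ _ _ Hc wj) -mulrA -signr_addb addbb.
by rewrite expr0 mulr1.
Qed.

(** * Face numbers, h-polynomial and gamma-vector *)

Lemma simplices_arrD {R : realType} {n s i : nat} : (2 <= n)%N -> (i <= n)%N ->
  simplices (arrD R n s) (n%:Z - 1 - i%:Z) =
  [set face (arrD R n s) (point R w) | w in [set` canon_words n s (n - i)]].
Proof.
(* The rank is [n], so simplices of dimension [n - 1 - i] are cones of dimension [n - i]. *)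
move=> n2 le_in; rewrite /simplices arr_rank_arrD // subnn.
apply/seteqP; split=> c /=.
  move=> [/cone_face[x ->] [m dim_m km]].
  have [m' [w [le_mn ww sxw]]] := exists_canon_word s x.
  have fw : face (arrD R n s) x = face (arrD R n s) (point R w) by apply/faceD_eqP.
  exists w => //=; rewrite -(_ : m' = (n - i)%N) //.
  rewrite fw in dim_m; have := cone_dim_uniq dim_m (face_point_dim le_mn ww).
  by lia.
move=> [w /= ww <-]; split; first exact/face_cone/regular_arrD.
exists (n - i)%N; first by apply: face_point_dim ww; lia.
lia.
Qed.

Lemma f_number_arrD {R : realType} {n s i : nat} : (2 <= n)%N -> (i <= n)%N ->
  f_number (arrD R n s) (n%:Z - 1 - i%:Z) = #|canon_words n s (n - i)|.
Proof.
move=> n2 le_in; rewrite /f_number simplices_arrD //.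
set W := canon_words _ _ _; apply: card_fset_set.
pose w0 : word n := [ffun=> None].
have memW k : (k < #|W|)%N -> nth w0 (enum W) k \in W.
  by move=> ltk; rewrite -mem_enum mem_nth // -cardE.
(* The words are numbered by [k < #|W|], so that injectivity of the numbering gives the cardinal. *)
have -> : [set face (arrD R n s) (point R w) | w in [set` W]] =
    [set face (arrD R n s) (point R (nth w0 (enum W) k)) | k in `I_#|W|].
  apply/seteqP; split=> c [x /= xW <-]; last by exists (nth w0 (enum W) x) => //=; apply: memW.
  exists (index x (enum W)); last by rewrite nth_index // mem_enum.
  by rewrite /= cardE index_mem mem_enum.
apply: inj_card_eq => k l; rewrite !inE /= => ltk ltl /faceD_eqP ss.
have := memW _ ltk; have := memW _ ltl; rewrite !inE => /andP[/eqP ll cl] /andP[/eqP lk ck].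
have /eqP := canon_inj lk ll ck cl ss.
by rewrite nth_uniq ?enum_uniq -?cardE // => /eqP.
Qed.

Lemma h_poly_arrD {R : realType} {n s : nat} : (2 <= n)%N -> (s <= n)%N ->
  h_poly (arrD R n s) = eul 1 n - (n - s)%:R *: ('X * eul 0 n.-1).
Proof.
move=> n2 le_sn; rewrite /h_poly arr_rank_arrD //.
(* The reversed index is the dimension [m] of the cones, matching the sums in [eul] and
   [mulX_eul]. *)
rewrite (reindex_inj rev_ord_inj) /=.
case: n n2 le_sn => // n n2 le_sn.
rewrite mulX_eul scaler_sumr -sumrB; apply: eq_bigr => m _.
have le_mn : (m <= n.+1)%N by rewrite -ltnS.
rewrite subSS f_number_arrD ?leq_subr // subKn // -(card_canon_words le_sn le_mn).
by rewrite natrD natrM scalerDl -scalerA addrK.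
Qed.

Lemma gamma_uniq {R : realType} {n : nat} (A : arrangement R n) (g : nat -> int) :
  is_gamma_vector A g -> gamma A =1 g.
Proof.
move=> gA k; have [g0 gE] := gA.
have [h0 hE] : is_gamma_vector A (gamma A) by apply: xgetPex; exists g.
have [lt_k|le_k] := ltnP (arr_rank A)./2 k; first by rewrite g0 // h0.
apply/eqP; rewrite -subr_eq0; apply/eqP.
apply: (@gamma_basis_free (arr_rank A) (fun i => gamma A i - g i)) => //.
under eq_bigr do rewrite scalerBl.
by rewrite sumrB -[X in X - _]hE -[X in _ - X]gE subrr.
Qed.

Lemma gamma_arrD {R : realType} {n : nat} : (2 <= n)%N ->
  exists gB gA : nat -> int, forall s k, (s <= n)%N ->
    gamma (arrD R n s) k = gB k - (n - s)%:R * gA k.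
Proof.
move=> n2; have [gB gBE] := gamma_span_eul1 n.
have [gA gAE] : gamma_span n ('X * eul 0 n.-1).
  by have := @gamma_span_eul0 n.-1; rewrite prednK; [apply; lia | lia].
(* The expansions leave the values beyond [n./2] free, whereas a gamma-vector must vanish there. *)
exists (fun k => if (k <= n./2)%N then gB k else 0).
exists (fun k => if (k <= n./2)%N then gA k else 0) => s k le_sn.
move: k; apply: gamma_uniq; split=> [i|]; rewrite arr_rank_arrD //.
  by rewrite ltnNge => /negbTE ->; rewrite mulr0 subr0.
rewrite h_poly_arrD // gBE gAE scaler_sumr -sumrB; apply: eq_bigr => i _.
by rewrite -ltnS ltn_ord scalerBl scalerA.
Qed.

Theorem theorem3p11 (R : realType) (n : nat) (hn : (2 <= n)%N)
    (k s t : nat) (hs : (s < n)%N) (ht : (t < n)%N) :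
  gamma (arrD R n s.+1) k - gamma (arrD R n s) k =
  gamma (arrD R n t.+1) k - gamma (arrD R n t) k.
Proof.
have [gB [gA gE]] := @gamma_arrD R n hn.
(* Passing from [u] to [u.+1] lowers the factor [n - u] by one, so the common difference is
   [gA k]. *)
have step u : (u < n)%N ->
    gamma (arrD R n u.+1) k - gamma (arrD R n u) k = gA k.
  move=> lt_un; rewrite !gE ?(ltnW lt_un) //.
  by rewrite -(subnSK lt_un) -natr1; ring.
by rewrite !step.
Qed.
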